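(* Let $G=(X,E)$ be a graph on $d$ vertices. Then (i) $\Delta(\mathrm{ap}(\mathcal{S}_G)^\sharp) = \mathcal{D}_X\cap\mathrm{ap}(\mathcal{S}_G)^\sharp = \mathrm{vp}(G)^\flat$; (ii) $\Delta(\mathrm{cp}(\mathcal{S}_G)^\sharp) = \mathcal{D}_X\cap\mathrm{cp}(\mathcal{S}_G)^\sharp = \mathrm{fvp}(G)$; (iii) $\Delta(\mathrm{fp}(\mathcal{S}_G)^\sharp) = \mathcal{D}_X\cap\mathrm{fp}(\mathcal{S}_G)^\sharp = \mathrm{fvp}(G)$.
   Context: Graphs are finite, undirected and without loops. Write $x\sim y$ if $\{x,y\}\in E$ and $x\simeq y$ if $x\sim y$ or $x=y$. Identify $X$ with $\{1,\dots,d\}$, let $(e_x)_{x\in X}$ be the canonical orthonormal basis of $H=\mathbb{C}^d$, and set $\mathcal{S}_G=\mathrm{span}\{e_xe_y^* : x\simeq y\}\subseteq M_d=\mathcal{L}(H)$, where $\xi\eta^*$ is the operator $\zeta\mapsto\langle\zeta,\eta\rangle\xi$ (inner products linear in the first variable). $\mathcal{D}_X$ is the algebra of diagonal matrices with respect to $(e_x)_{x\in X}$, $\mathcal{D}_X^+$ its positive cone, and $\Delta:M_d\to\mathcal{D}_X$ the conditional expectation (deleting the off-diagonal entries). Vectors in $\mathbb{R}^d$ are identified with the corresponding diagonal matrices. A set $S\subseteq X$ is independent (resp. a clique) if $x\not\sim y$ (resp. $x\sim y$) for all distinct $x,y\in S$. $\mathrm{vp}(G)=\mathrm{conv}\{\chi_S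 : S\subseteq X \text{ independent}\}$ ($\chi_S$ the characteristic function of $S$), and $\mathrm{fvp}(G)=\{x\in\mathbb{R}^d_+ : \sum_{i\in K}x_i\le 1 \text{ for all cliques } K\subseteq X\}$. For a non-empty $\mathcal{A}\subseteq\mathcal{L}(H)^+$, $\mathcal{A}^\sharp=\{B\in\mathcal{L}(H)^+ : \mathrm{Tr}(AB)\le 1\ \forall A\in\mathcal{A}\}$; for a non-empty $\mathcal{C}\subseteq\mathcal{D}_X^+$, $\mathcal{C}^\flat=\{B\in\mathcal{D}_X^+ : \mathrm{Tr}(AB)\le 1\ \forall A\in\mathcal{C}\}$. An operator system in $\mathcal{L}(H)$ is a linear subspace $\mathcal{S}$ containing $I$ and closed under adjoints. ''Projection'' means orthogonal projection. An $\mathcal{S}$-clique is a set $\{\xi_i\}_{i=1}^m$ of mutually orthogonal unit vectors in $H$ with $\xi_i\xi_j^*\in\mathcal{S}$ whenever $i\ne j$. A projection $P$ is $\mathcal{S}$-abelian if $P\mathcal{S}P$ is contained in an abelian C*-subalgebra of $\mathcal{L}(H)$; $\mathcal{S}$-clique if its range is the span of an $\mathcal{S}$-clique; $\mathcal{S}$-full if $\mathcal{L}(PH)\oplus 0_{P^\perp}\subseteq\mathcal{S}$. For $\mathcal{C}\subseteq\mathcal{L}(H)$, $\mathrm{her}(\mathcal{C})=\{A\in\mathcal{L}(H)^+ : \exists B\in\mathcal{C},\ A\le B\}$. The sets $\mathrm{ap}(\mathcal{S})$, $\mathrm{cp}(\mathcal{S})$, $\mathrm{fp}(\mathcal{S})$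 are $\mathrm{her}(\overline{\mathrm{conv}}(\mathcal{P}))$ where $\mathcal{P}$ is the set of all $\mathcal{S}$-abelian, respectively $\mathcal{S}$-clique, respectively $\mathcal{S}$-full projections. *)

(* Defs.v *)
From mathcomp Require Import all_boot all_order all_algebra.
From mathcomp Require Export complex.
From mathcomp Require Import all_classical all_reals all_analysis.

Set Implicit Arguments.
Unset Strict Implicit.
Unset Printing Implicit Defensive.

Import numFieldNormedType.Exports.
Import Order.TTheory GRing.Theory Num.Theory.

Local Open Scope classical_set_scope.
Local Open Scope ring_scope.
Local Open Scope complex_scope.
Local Open Scope sesquilinear_scope.

Section Hilbert.
Context {R : realType} {d : nat}.
Implicit Types (xi eta : 'cV[R[i]]_d) (A B P : 'M[R[i]]_d).

(* Linear in the first variable. *)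
Definition inner xi eta : R[i] := (eta ^t* *m xi) 0 0.

(* The operator xi eta^* : zeta |-> <zeta, eta> xi. *)
Definition rank_one xi eta : 'M[R[i]]_d := xi *m eta ^t*.

Definition basis_vec (x : 'I_d) : 'cV[R[i]]_d := delta_mx x 0.

(* In the order of R[i], 0 <= z means that z is a nonnegative real number, so
   positive operators are automatically self-adjoint. *)
Definition positive_op A : Prop := forall xi, 0 <= inner (A *m xi) xi.

Definition le_op A B : Prop := positive_op (B - A).

Definition projection P : Prop := P ^t* = P /\ P *m P = P.

Definition diag_algebra : set 'M[R[i]]_d := [set A | is_diag_mx A].

Definition diag_algebra_pos : set 'M[R[i]]_d :=
  [set A | diag_algebra A /\ positive_op A].

Definition Delta A : 'M[R[i]]_d := diag_mx (\row_i A i i).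

Definition diag_of_real (x : 'rV[R]_d) : 'M[R[i]]_d :=
  diag_mx (\row_i (x 0 i)%:C).

End Hilbert.

(* Convex hull of A. For K = R[i] the weights range over the t : K with
   0 <= t <= 1, which are exactly the real numbers of the unit interval. *)
Definition conv_hull (K : numDomainType) (V : lmodType K) (A : set V) : set V :=
  smallest (@convex_set K V) A.

(* The norm topology of M_d: R[i]^o is R[i] with the topology of its norm. *)
Definition mx_closure (R : realType) (d : nat) (A : set 'M[R[i]]_d) :
  set 'M[R[i]]_d := closure (A : set 'M[R[i]^o]_d).

Section Polarity.
Context {R : realType} {d : nat}.
Implicit Types A C : set 'M[R[i]]_d.

Definition her C : set 'M[R[i]]_d :=
  [set X | positive_op X /\ exists2 B, C B & le_op X B].

(* The trace below is real, being that of a product of two positive operators,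
   whenever the given set consists of positive operators. *)
Definition sharp A : set 'M[R[i]]_d :=
  [set B | positive_op B /\ forall X, A X -> \tr (X *m B) <= 1].

Definition flat C : set 'M[R[i]]_d :=
  [set B | diag_algebra_pos B /\ forall X, C X -> \tr (X *m B) <= 1].

End Polarity.

Section OperatorSystem.
Context {R : realType} {d : nat}.
Implicit Types (S A : {vspace 'M[R[i]]_d}) (P : 'M[R[i]]_d).

(* Linear subspaces of M_d are finite dimensional, hence norm closed. *)
Definition abelian_cstar_subalgebra A : Prop :=
  [/\ forall X, X \in A -> X ^t* \in A,
      forall X Y, X \in A -> Y \in A -> X *m Y \in A
    & forall X Y, X \in A -> Y \in A -> X *m Y = Y *m X].

Definition abelian_projection S P : Prop :=
  projection P /\
  exists A, abelian_cstar_subalgebra A /\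
            forall X, X \in S -> P *m X *m P \in A.

Definition is_sclique S (m : nat) (xi : 'I_m -> 'cV[R[i]]_d) : Prop :=
  [/\ forall i, inner (xi i) (xi i) = 1,
      forall i j, i != j -> inner (xi i) (xi j) = 0
    & forall i j, i != j -> rank_one (xi i) (xi j) \in S].

Definition clique_projection S P : Prop :=
  projection P /\
  exists (m : nat) (xi : 'I_m -> 'cV[R[i]]_d),
    is_sclique S xi /\ range (fun v : 'cV[R[i]]_d => P *m v) =
      [set v : 'cV[R[i]]_d | v \in <<[seq xi i | i : 'I_m]>>%VS].

(* L(PH) (+) 0 consists of the operators T with T = P T P. *)
Definition full_projection S P : Prop :=
  projection P /\ forall T, P *m T *m P = T -> T \in S.

Definition ap S : set 'M[R[i]]_d :=
  her (mx_closure (conv_hull (abelian_projection S))).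

Definition cp S : set 'M[R[i]]_d :=
  her (mx_closure (conv_hull (clique_projection S))).

Definition fp S : set 'M[R[i]]_d :=
  her (mx_closure (conv_hull (full_projection S))).

End OperatorSystem.

Section Graph.
Context (R : realType) {d : nat} (e : rel 'I_d).

Definition graph_system : {vspace 'M[R[i]]_d} :=
  <<[seq rank_one (basis_vec p.1) (basis_vec p.2)
      | p : 'I_d * 'I_d in [pred p | e p.1 p.2 || (p.1 == p.2)]]>>%VS.

Definition independent (S : {set 'I_d}) : Prop :=
  {in S &, forall x y, x != y -> ~~ e x y}.

Definition clique (S : {set 'I_d}) : Prop :=
  {in S &, forall x y, x != y -> e x y}.

Definition char_vec (S : {set 'I_d}) : 'rV[R]_d := \row_i (i \in S)%:R.

Definition vp : set 'rV[R]_d :=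
  conv_hull [set x | exists2 S, independent S & x = char_vec S].

Definition fvp : set 'rV[R]_d :=
  [set x | (forall i, 0 <= x 0 i) /\
           forall K : {set 'I_d}, clique K -> \sum_(i in K) x 0 i <= 1].

End Graph.

Arguments vp R {d} e.
Arguments fvp R {d} e.

(* Main.v *)
Require Import Defs.
From mathcomp Require Import all_boot all_order all_algebra.
From mathcomp Require Import all_classical all_reals all_analysis.

(** A diagonal matrix only sees the diagonal of the matrices it is paired with
    by the trace, so the diagonal part of each polar is decided by the diagonals
    of the projections P in the generating class. The heart of the matter is
    that, for any projection P and any real weights b, there is a coordinate set
    J such that P is injective on the vectors supported on J and
    sum_x b_x P_xx <= sum_(x in J) b_x ([greedy_basis]). In matroid terms, the
    diagonal of P is in the base polytope of the column matroid of P; the set J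
    is found by the greedy algorithm.

    The graph enters through injectivity only. If P is injective on J and x, y
    are distinct points of J, then the columns P e_x and P e_y are linearly
    independent, and
    - if P is S_G-abelian, x and y are not adjacent, because an adjacency makes
      the operator (P e_x)(P e_y)^* normal, which forces dependent columns
      ([abelian_projection_independent]);
    - if P is S_G-clique or S_G-full, x and y are adjacent, because the vanishing
      of the (x, y) entries on S_G forces dependent columns
      ([clique_projection_clique], [full_projection_clique]).
    So J is an independent set, respectively a clique. Conversely the coordinate
    projection of an independent set is abelian, and that of a clique is both
    clique and full. Hence a diagonal b >= 0 is in the polar of the class exactly
    when its sum over every such set is at most 1; this passes from the class
    to its closed convex hereditary hull because the bound on the trace is a
    closed convex condition inherited by smaller operators
    ([her_hull_mxtrace_le1]). The compression Delta B of a member B of the polar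
    satisfies the same inequalities, as they only test coordinate projections.
    All this is [sharp_her_hull]; for cliques the resulting polytope is fvp(G),
    and for independent sets it is the polar of vp(G) ([flat_vp]). *)

Import numFieldNormedType.Exports.
Import Order.TTheory GRing.Theory Num.Theory.

Local Open Scope classical_set_scope.

(** * Greedy bases of a projection *)

Section Greedy.
Local Open Scope ring_scope.
Local Open Scope complex_scope.
Local Open Scope sesquilinear_scope.
Context {R : realType} {d : nat}.
Implicit Types (P : 'M[R[i]]_d) (J : {set 'I_d}) (x y : 'I_d).

(** Linear independence of the columns of P indexed by J. In this form it passes
    from Q *m P to P at once. *)
Definition injective_on P J : Prop :=
  forall v : 'cV[R[i]]_d,
    (forall i, i \notin J -> v i 0 = 0) -> P *m v = 0 -> v = 0.

(** When P is a projection with P e_x <> 0, this is P minus the projection onto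
    the line spanned by P e_x: one step of the greedy algorithm. *)
Definition deflate P x : 'M[R[i]]_d :=
  P - (P x x)^-1 *: (col x P *m row x P).

Lemma deflateE P x : deflate P x = (1%:M - (P x x)^-1 *: (col x P *m delta_mx 0 x)) *m P.
Proof. by rewrite mulmxBl mul1mx -scalemxAl -mulmxA -rowE. Qed.

Lemma projection_conj P x y : projection P -> (P x y)^*%R = P y x.
Proof. by case=> /matrixP/(_ y x); rewrite !mxE. Qed.

Lemma projection_diag P x : projection P -> P x x = \sum_y `|P x y| ^+ 2.
Proof.
move=> hP; rewrite -{1}(proj2 hP) mxE; apply: eq_bigr => y _.
by rewrite normCK projection_conj.
Qed.

Lemma projection_diag_eq0 P x : projection P -> P x x = 0 -> forall y, P x y = 0.
Proof.
move=> hP; rewrite projection_diag // => /eqP.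
rewrite psumr_eq0 => [/allP h y|y _]; last exact: exprn_ge0.
by have := h y (mem_index_enum y); rewrite /= sqrf_eq0 normr_eq0 => /eqP.
Qed.

Lemma deflate_entry P x y z : deflate P x y z = P y z - (P x x)^-1 * (P y x * P x z).
Proof. by rewrite !mxE big_ord1 !mxE. Qed.

Lemma mul_row_col_projection P x y : projection P ->
  row x P *m col y P = (P x y)%:M.
Proof.
move=> [_ PP]; rewrite colE mulmxA rowE -[_ *m P *m P]mulmxA PP -colE -rowE.
by apply/matrixP => i j; rewrite !ord1 !mxE.
Qed.

Lemma deflate_projection P x : projection P -> P x x != 0 -> projection (deflate P x).
Proof.
move=> hP nz; have [_ PP] := hP; split.
  apply/matrixP => y z; rewrite mxE [_^T _ _]mxE !deflate_entry.
  rewrite rmorphB !rmorphM fmorphV /=. rewrite !projection_conj //.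
  by rewrite [P x z * _]mulrC.
have Pc : P *m col x P = col x P by rewrite colE mulmxA PP.
have rP : row x P *m P = row x P by rewrite rowE -mulmxA PP.
have rc := mul_row_col_projection P x x hP.
rewrite /deflate; set k := (P x x)^-1.
rewrite mulmxBl !mulmxBr PP -!scalemxAl -!scalemxAr mulmxA Pc -mulmxA rP.
rewrite !mulmxA -[_ *m _ *m col x P]mulmxA rc mul_mx_scalar -scalemxAl.
by rewrite !scalerA [k * _]mulrC mulfK // subrr subr0.
Qed.

(** The deflated projection has the form Q *m P and kills e_x, so a vector in the
    kernel of P supported on x |: J is a multiple of e_x, and P e_x <> 0. *)
Lemma deflate_injective_on P x J : P x x != 0 ->
  injective_on (deflate P x) J -> injective_on P (x |: J).
Proof.
move=> nz inj v vJ Pv.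
have v1 : v - v x 0 *: delta_mx x 0 = 0.
  apply: inj => [i iJ|].
    rewrite !mxE eqxx andbT; case: eqVneq => [->|ix]; first by rewrite mulr1 subrr.
    by rewrite mulr0 subr0 vJ // !inE negb_or ix.
  rewrite mulmxBr deflateE -mulmxA Pv mulmx0 -deflateE sub0r -scalemxAr -colE.
  apply/eqP; rewrite oppr_eq0; apply/eqP/matrixP => i j.
  by rewrite !mxE big_ord1 !mxE mulrCA mulVf // mulr1 subrr mulr0.
have /eqP := Pv; rewrite -(subrK (v x 0 *: delta_mx x 0) v) v1 add0r.
rewrite -scalemxAr scaler_eq0 => /orP[/eqP->|]; first by rewrite scale0r.
rewrite -colE => /eqP/matrixP/(_ x 0); rewrite !mxE => /eqP.
by rewrite (negbTE nz).
Qed.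

(** Choose x of maximal weight among the indices with P e_x <> 0 and deflate.
    The diagonal of P loses the vector (|P_xy|^2 / P_xx)_y, which has total mass
    1 and is carried by indices of weight at most b_x, so the weighted trace
    drops by at most b_x, which is what adding x to J pays for. *)
Lemma greedy_basis P (b : 'I_d -> R) : projection P ->
  exists2 J, injective_on P J &
    \sum_x P x x * (b x)%:C <= (\sum_(x in J) b x)%:C.
Proof.
have [n] := ubnP #|[pred x | P x x != 0]|.
elim: n P => // n IH P; rewrite ltnS => cardP hP.
case: (pickP [pred x | P x x != 0]) => [x0 Px0|P0]; last first.
  exists finset.set0 => [v v0 _|].
    by apply/matrixP => i j; rewrite ord1 v0 ?inE // mxE.
  rewrite big_set0 big1 // => x _.
  by move/negbFE/eqP: (P0 x) => /= ->; rewrite mul0r.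
case: (arg_maxP b Px0) => x /= Px xmax.
set P' := deflate P x; have hP' : projection P' := deflate_projection _ _ hP Px.
have P'x y : P' y x = 0 by rewrite deflate_entry mulrCA mulVf // mulr1 subrr.
have [|J injJ leJ] := IH P' _ hP'.
  apply: leq_trans cardP; apply: proper_card.
  apply/properP; split; last by exists x; rewrite inE ?P'x ?eqxx.
  apply/fintype.subsetP => y; rewrite !inE; have [Py|//] := eqVneq (P y y) 0.
  have Py0 := projection_diag_eq0 _ _ hP Py.
  by rewrite deflate_entry !Py0 mul0r mulr0 subr0 eqxx.
(* The deflation kills e_x, so x is not already in J. *)
have xJ : x \notin J.
  apply/negP => xJ; have ex0 : delta_mx x 0 = 0 :> 'cV[R[i]]_d.
    apply: injJ => [i iJ|]; last first.
      by rewrite -colE; apply/matrixP => i j; rewrite [LHS]mxE P'x mxE.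
    by rewrite mxE andbT; case: eqP iJ => // ->; rewrite xJ.
  by move/matrixP/(_ x 0)/eqP: ex0; rewrite !mxE !eqxx oner_eq0.
exists (x |: J); first exact: deflate_injective_on.
rewrite big_setU1 //= rmorphD addrC.
have -> : \sum_y P y y * (b y)%:C =
    \sum_y P' y y * (b y)%:C + (P x x)^-1 * \sum_y `|P x y| ^+ 2 * (b y)%:C.
  rewrite mulr_sumr -big_split; apply: eq_bigr => y _ /=.
  rewrite deflate_entry normCK projection_conj //.
  by rewrite [P x y * _]mulrC [X in _ + X]mulrA -mulrDl subrK.
apply: lerD => //; rewrite -[leRHS]mul1r -(mulVf Px) -mulrA.
have P0 : 0 <= P x x by rewrite projection_diag // sumr_ge0 // => y _; exact: exprn_ge0.
rewrite ler_wpM2l ?invr_ge0 // {1}(projection_diag _ x) // mulr_suml.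
apply: ler_sum => y _; have [Py|Py] := eqVneq (P y y) 0.
  by rewrite -projection_conj // projection_diag_eq0 // conjC0 normr0 expr0n !mul0r.
by rewrite ler_wpM2l ?exprn_ge0 // lecR xmax.
Qed.
End Greedy.

(** * Projections injective on a coordinate set *)

Section Kernel.
Local Open Scope ring_scope.
Local Open Scope complex_scope.
Local Open Scope sesquilinear_scope.
Context {R : realType} {d : nat}.
Implicit Types (P : 'M[R[i]]_d) (J : {set 'I_d}) (x y : 'I_d).

(** The form in which injectivity meets the graph, whose constraints concern one
    pair of vertices at a time. *)
Lemma injective_on_pair {P J x y} a b : injective_on P J ->
  x \in J -> y \in J -> x != y -> a *: col x P + b *: col y P = 0 -> a = 0 /\ b = 0.
Proof.
move=> inj xJ yJ xy; rewrite !colE !scalemxAr -mulmxDr => /inj v0.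
have {}v0 : a *: delta_mx x 0 + b *: delta_mx y 0 = 0 :> 'cV[R[i]]_d.
  apply: v0 => i iJ; rewrite !mxE !eqxx !andbT.
  case: eqP iJ => [->|_]; first by rewrite xJ.
  by case: eqP => [->|_]; rewrite ?yJ // !mulr0 addr0.
split; [move/matrixP/(_ x 0): v0|move/matrixP/(_ y 0): v0]; rewrite !mxE !eqxx.
  by rewrite (negbTE xy) mulr1 mulr0 addr0.
by rewrite eq_sym (negbTE xy) mulr1 mulr0 add0r.
Qed.

Lemma injective_on_diag_neq0 P J x : projection P ->
  injective_on P J -> x \in J -> P x x != 0.
Proof.
move=> hP inj xJ; apply/eqP => /(projection_diag_eq0 _ _ hP) Px.
suff /matrixP/(_ x 0)/eqP : delta_mx x 0 = 0 :> 'cV[R[i]]_d.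
  by rewrite !mxE !eqxx oner_eq0.
apply: inj => [i iJ|]; first by rewrite mxE andbT; case: eqP iJ => // ->; rewrite xJ.
by rewrite -colE; apply/matrixP => i j; rewrite !mxE -projection_conj // Px conjC0.
Qed.

Lemma inner_eq0 (w : 'cV[R[i]]_d) : w ^t* *m w = 0 -> w = 0.
Proof.
move/matrixP/(_ 0 0)/eqP; rewrite !mxE psumr_eq0 => [/allP w0|i _]; last first.
  by rewrite !mxE mulrC mul_conjC_ge0.
apply/matrixP => i j; rewrite ord1 mxE; apply/eqP.
by have := w0 i (mem_index_enum i); rewrite !mxE /= mulrC mul_conjC_eq0.
Qed.

(** P v is in the span of the xi i, and its square norm is its inner product with
    v, which vanishes. *)
Lemma mul_projection_eq0 P m (xi : 'I_m -> 'cV[R[i]]_d) (v : 'cV[R[i]]_d) :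
  projection P ->
  range (fun w : 'cV[R[i]]_d => P *m w) =
    [set w : 'cV[R[i]]_d | w \in <<[seq xi i | i : 'I_m]>>%VS] ->
  (forall i, (xi i) ^t* *m v = 0) -> P *m v = 0.
Proof.
move=> [Ph PP] rg orth; apply: inner_eq0.
have -> : (P *m v) ^t* *m (P *m v) = (P *m v) ^t* *m v.
  by rewrite trmx_mul map_mxM Ph !mulmxA -[_ *m P *m P]mulmxA PP.
have : P *m v \in <<[seq xi i | i : 'I_m]>>%VS.
  suff : (range (fun w : 'cV[R[i]]_d => P *m w)) (P *m v) by rewrite rg.
  by exists v.
move=> /(@coord_span _ _ _ (in_tuple _)) {1}->.
rewrite linear_sum raddf_sum mulmx_suml big1 // => i _.
have [j ->] : exists j, (in_tuple [seq xi i | i : 'I_m])`_i = xi j.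
  suff /fintype.imageP[j _ eqj] : (in_tuple [seq xi i | i : 'I_m])`_i \in
      [seq xi j | j : 'I_m] by exists j.
  by rewrite mem_nth.
by rewrite /= linearZ map_mxZ -scalemxAl orth scaler0.
Qed.
End Kernel.

(** * Constraints of the graph on injectivity sets *)

Section System.
Local Open Scope ring_scope.
Local Open Scope complex_scope.
Local Open Scope sesquilinear_scope.
Context {R : realType} {d : nat} (e : rel 'I_d).
Implicit Types (P : 'M[R[i]]_d) (J : {set 'I_d}) (x y : 'I_d).
Local Notation S_G := (graph_system R e).

Lemma rank_one_entry (xi eta : 'cV[R[i]]_d) x y :
  rank_one xi eta x y = xi x 0 * (eta y 0)^*%R.
Proof. by rewrite mxE big_ord1 !mxE. Qed.

Lemma rank_one_basis x y :
  rank_one (basis_vec x) (basis_vec y) = delta_mx x y :> 'M[R[i]]_d.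
Proof. by rewrite /rank_one trmx_delta map_delta_mx mul_delta_mx. Qed.

Lemma graph_systemP (X : 'M[R[i]]_d) :
  X \in S_G <-> forall x y, ~~ (e x y || (x == y)) -> X x y = 0.
Proof.
split=> [/(@coord_span _ _ _ (in_tuple _)) -> x y nxy|X0].
  rewrite summxE big1 // => i _; rewrite mxE [X in _ * X](_ : _ = 0) ?mulr0 //.
  set L := image_mem _ _; have /fintype.imageP[[x' y'] + ->] : (in_tuple L)`_i \in L.
    by rewrite mem_nth.
  rewrite inE /= rank_one_basis mxE => exy.
  case: (@andP (x == x') (y == y')) => // -[/eqP xx' /eqP yy'].
  by move: nxy; rewrite xx' yy' exy.
suff : \sum_x \sum_y X x y *: delta_mx x y \in S_G by rewrite -matrix_sum_delta.
apply: rpred_sum => x _; apply: rpred_sum => y _.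
have [exy|/X0 ->] := boolP (e x y || (x == y)); last by rewrite scale0r rpred0.
rewrite rpredZ // memv_span // -rank_one_basis.
by apply/fintype.imageP; exists (x, y).
Qed.

Lemma delta_graph_system x y : e x y -> delta_mx x y \in S_G.
Proof.
move=> exy; apply/graph_systemP => x' y'; rewrite mxE.
by case: (@andP (x' == x) (y' == y)) => // -[/eqP -> /eqP ->]; rewrite exy.
Qed.

(** If x and y are adjacent, both P e_x e_y^* P and P e_y e_x^* P lie in the
    abelian algebra. Their commutation reads
    P_yy (P e_x)(P e_x)^* = P_xx (P e_y)(P e_y)^*; applied to e_x, this is a
    linear relation between P e_x and P e_y with leading coefficient
    P_xx P_yy <> 0. *)
Lemma abelian_projection_independent (e_sym : symmetric e) P J :
  abelian_projection S_G P -> injective_on P J -> independent e J.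
Proof.
move=> [hP [A [[_ _ comA] PSA]]] inj x y xJ yJ xy; apply/negP => exy.
have sandwich x' y' : P *m delta_mx x' y' *m P = col x' P *m row y' P.
  by rewrite colE rowE -(mul_delta_mx (0 : 'I_1)) !mulmxA.
have prod x' y' : (P *m delta_mx x' y' *m P) *m (P *m delta_mx y' x' *m P) =
    P y' y' *: (col x' P *m row x' P).
  rewrite !sandwich -[LHS]mulmxA [row y' P *m (_ *m _)]mulmxA mul_row_col_projection //.
  by rewrite mul_scalar_mx -scalemxAr.
have Px : P x x * P y y != 0.
  by rewrite mulf_neq0 // (injective_on_diag_neq0 _ _ _ hP inj).
have exy' : e y x by rewrite e_sym.
have := comA _ _ (PSA _ (delta_graph_system x y exy))
  (PSA _ (delta_graph_system y x exy')).
rewrite !prod => /(congr1 (mulmx^~ (delta_mx x 0 : 'cV_d))).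
have rowx z : row z P *m (delta_mx x 0 : 'cV_d) = (P z x)%:M.
  by rewrite -colE; apply/matrixP => i j; rewrite !ord1 !mxE.
rewrite -!scalemxAl -[X in _ *: X = _]mulmxA -[X in _ = _ *: X]mulmxA !rowx.
rewrite !mul_mx_scalar !scalerA => /eqP; rewrite -subr_eq0 -scaleNr => /eqP.
case/(injective_on_pair _ _ inj xJ yJ xy) => /eqP; rewrite mulrC.
by rewrite (negbTE Px).
Qed.

(** P e_x e_y^* P is in the system; its (x, y) entry is P_xx P_yy, which is not
    zero, so x and y are adjacent. *)
Lemma full_projection_clique P J :
  full_projection S_G P -> injective_on P J -> clique e J.
Proof.
move=> [hP PS] inj x y xJ yJ xy; apply/negPn/negP => nexy.
have /graph_systemP/(_ x y) : P *m delta_mx x y *m P \in S_G.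
  by apply: PS; rewrite !mulmxA (proj2 hP) -!mulmxA (proj2 hP).
rewrite (negbTE nexy) (negbTE xy) => /(_ isT)/eqP.
rewrite -(mul_delta_mx (0 : 'I_1)) !mulmxA -colE -mulmxA -rowE mxE big_ord1 !mxE.
by rewrite mulf_eq0 !(negbTE (injective_on_diag_neq0 _ _ _ hP inj _)).
Qed.

(** For x and y neither equal nor adjacent, xi_i(x) xi_j(y) = 0 whenever i != j.
    Take i with xi_i(x) != 0, which exists as P e_x <> 0. The vector with
    coordinate conj xi_i(y) at x and - conj xi_i(x) at y is then orthogonal to
    every xi_j, so it is a nonzero element of the kernel of P supported on J. *)
Lemma clique_projection_clique P J :
  clique_projection S_G P -> injective_on P J -> clique e J.
Proof.
move=> [hP [m [xi [[_ _ xiS] rg]]]] inj x y xJ yJ xy; apply/negPn/negP => nexy.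
have xi0 i j : i != j -> xi i x 0 * xi j y 0 = 0.
  move=> ij; have /graph_systemP/(_ x y) := xiS _ _ ij.
  rewrite rank_one_entry (negbTE nexy) (negbTE xy) => /(_ isT)/eqP.
  by rewrite mulf_eq0 conjC_eq0 -mulf_eq0 => /eqP.
(* Orthogonality to the clique of a vector supported on x and y. *)
have mulP a b : (forall i, a * (xi i x 0)^*%R + b * (xi i y 0)^*%R = 0) -> a = 0 /\ b = 0.
  move=> ab; apply: (injective_on_pair _ _ inj xJ yJ xy).
  rewrite !colE !scalemxAr -mulmxDr; apply: (mul_projection_eq0 _ _ _ _ hP rg) => i.
  apply/matrixP => j k; rewrite !ord1 mulmxDr -!scalemxAr -!colE !mxE.
  exact: ab.
have [i xi_neq0] : exists i, xi i x 0 != 0.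
  apply: contrapT => /forallNP xi_eq0.
  have [|/eqP] := mulP 1 0; last by rewrite oner_eq0.
  by move=> i; move/negP/negPn/eqP: (xi_eq0 i) => ->; rewrite conjC0 mulr0 mul0r addr0.
have [j|_ /eqP] := mulP (xi i y 0)^*%R (- (xi i x 0)^*%R); last first.
  by rewrite oppr_eq0 conjC_eq0 (negbTE xi_neq0).
have [<-|ij] := eqVneq i j; first by rewrite mulNr mulrC subrr.
have ji : j != i by rewrite eq_sym.
by rewrite mulNr -!rmorphM [xi i y 0 * _]mulrC (xi0 _ _ ji) (xi0 _ _ ij) rmorph0 subr0.
Qed.
End System.

(** * Half-spaces and convex hulls *)

Section HalfSpace.
Local Open Scope ring_scope.

Lemma conv_hull_le1 (K : numDomainType) (V : lmodType K) (A : set V) (f : V -> K) :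
  scalar f -> (forall x, A x -> f x <= 1) -> forall x, conv_hull A x -> f x <= 1.
Proof.
move=> flin fA x; apply: (smallest_sub (X := [set y | f y <= 1])) => // y z l.
have f0 : f 0 = 0.
  by apply: (addrI (f 0)); have := flin 1 0 0; rewrite scaler0 mul1r !addr0.
have fZ k v : f (k *: v) = k * f v by rewrite -[k *: v]addr0 flin f0 addr0.
rewrite !inE /= => fy fz.
have -> : f (conv l y z) = l%:num * f y + (1 - l%:num) * f z.
  by rewrite (flin _ y ((1 - l%:num) *: z)) fZ.
rewrite -[leRHS](subrK l%:num) addrC lerD //.
- by rewrite -[leRHS]mulr1 ler_wpM2l.
- by rewrite -[leRHS]mulr1 ler_wpM2l // subr_ge0.
Qed.

(** In a possibly non-real field, z <= a means that a - z is its own norm, which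
    is a closed condition as the norm is continuous. *)
Lemma closed_half_line (K : numFieldType) (a : K) : closed [set z : K^o | z <= a].
Proof.
rewrite (_ : mkset _ = (fun z : K^o => `|a - z| - (a - z)) @^-1` [set 0]).
  apply: preimage_closed => [z _|]; last first.
    by apply: accessible_closed_set1; apply: hausdorff_accessible; exact: norm_hausdorff.
  have cB : {for z, continuous (fun w : K^o => a - w)}.
    by apply: (@continuousB K K^o K^o (cst a) id); [apply: cst_continuous|apply: cvg_id].
  apply: (@continuousB K K^o K^o (fun w => `|a - w|) (fun w => a - w)) => //.
  exact: (@continuous_comp _ _ _ (fun w : K^o => a - w) Num.norm _ cB
    (@norm_continuous _ _ _)).
apply/seteqP; split=> z /=; first by rewrite -subr_ge0 => /ger0_norm->; rewrite subrr.
by move/subr0_eq => az; rewrite -subr_ge0 -az normr_ge0.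
Qed.

End HalfSpace.

(** * The trace against a nonnegative diagonal matrix *)

Section Diagonal.
Local Open Scope ring_scope.
Local Open Scope complex_scope.
Local Open Scope sesquilinear_scope.
Context {R : realType} {d : nat}.
Implicit Types (X : 'M[R[i]]_d) (b : 'rV[R]_d).

Lemma mxtrace_mul_diag X b : \tr (X *m diag_of_real b) = \sum_i X i i * (b 0 i)%:C.
Proof. by apply: eq_bigr => i _; rewrite mul_mx_diag !mxE. Qed.

Lemma mxtrace_mul_diag_scalar b : scalar (fun X => \tr (X *m diag_of_real b)).
Proof. by move=> k X Y; rewrite mulmxDl -scalemxAl linearP. Qed.

Lemma positive_op_diag_ge0 X i : positive_op X -> 0 <= X i i.
Proof.
move/(_ (delta_mx i 0)); rewrite /inner trmx_delta map_delta_mx -colE -rowE.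
by rewrite !mxE.
Qed.

Lemma le_op_mxtrace X Y b : (forall i, 0 <= b 0 i) -> le_op X Y ->
  \tr (X *m diag_of_real b) <= \tr (Y *m diag_of_real b).
Proof.
move=> b0 XY; rewrite !mxtrace_mul_diag; apply: ler_sum => i _.
rewrite ler_wpM2r ?lecR // -subr_ge0.
by have := positive_op_diag_ge0 _ i XY; rewrite !mxE.
Qed.

Lemma closed_mxtrace_le1 b :
  closed ([set X | \tr (X *m diag_of_real b) <= 1] : set 'M[R[i]^o]_d).
Proof.
have cont : continuous (fun X : 'M[R[i]^o]_d => \tr (X *m diag_of_real b) : R[i]^o).
  under [X in continuous X]funext do rewrite mxtrace_mul_diag.
  apply: continuous_big => [|i _ X]; first exact: (@add_continuous R[i]^o).
  have cc : {for X, continuous (fun M : 'M[R[i]^o]_d => M i i : R[i]^o)}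
    by exact: (@coord_continuous R[i] d d i i).
  exact: (@continuousM R[i] _ _ (cst (b 0 i)%:C) _ cc (@cst_continuous _ _ _ _)).
apply: (preimage_closed _ (@closed_half_line R[i] 1)) => X _; exact: cont.
Qed.

Lemma her_hull_mxtrace_le1 (A : set 'M[R[i]]_d) b : (forall i, 0 <= b 0 i) ->
  (forall P, A P -> \tr (P *m diag_of_real b) <= 1) ->
  forall X, her (mx_closure (conv_hull A)) X -> \tr (X *m diag_of_real b) <= 1.
Proof.
move=> b0 bA X [_ [Y YA XY]]; apply: le_trans (le_op_mxtrace _ _ _ b0 XY) _.
apply: (closed_mxtrace_le1 b).
apply: (closureS (A := conv_hull A : set 'M[R[i]^o]_d)) YA => Z /=.
exact: conv_hull_le1 (mxtrace_mul_diag_scalar b) bA Z.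
Qed.

Lemma her_hull_projection (A : set 'M[R[i]]_d) P :
  A P -> projection P -> her (mx_closure (conv_hull A)) P.
Proof.
move=> AP [Ph PP]; split=> [xi|].
  have -> : inner (P *m xi) xi = \sum_i `|(P *m xi) i 0| ^+ 2.
    have -> : inner (P *m xi) xi = inner (P *m xi) (P *m xi).
      by rewrite /inner trmx_mul map_mxM Ph !mulmxA -[_ *m P *m P]mulmxA PP.
    rewrite /inner mxE.
    by apply: eq_bigr => i _; rewrite !mxE normCKC.
  by apply: sumr_ge0 => i _; exact: exprn_ge0.
exists P; first by apply: subset_closure; exact: sub_gen_smallest.
by move=> xi; rewrite subrr mul0mx /inner mulmx0 mxE.
Qed.

Lemma positive_diag_of_real b : (forall i, 0 <= b 0 i) -> positive_op (diag_of_real b).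
Proof.
move=> b0 xi; rewrite /inner mxE; apply: sumr_ge0 => i _.
rewrite mul_diag_mx !mxE mulrCA mulr_ge0 ?ler0c //.
by rewrite mulrC mul_conjC_ge0.
Qed.

Lemma diag_algebra_posP X : diag_algebra_pos X <->
  exists2 b : 'rV[R]_d, (forall i, 0 <= b 0 i) & X = diag_of_real b.
Proof.
split=> [[dX pX]|[b b0 ->]]; last first.
  by split; [exact: diag_mx_is_diag|exact: positive_diag_of_real].
have X0 i := positive_op_diag_ge0 _ i pX.
have ReX i : (complex.Re (X i i))%:C = X i i by rewrite RRe_real // ger0_real.
exists (\row_i complex.Re (X i i)) => [i|]; first by rewrite mxE -ler0c ReX.
apply/matrixP => i j; rewrite !mxE ReX; case: eqVneq => [->|ij] //.
by rewrite (is_diag_mxP dX).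
Qed.

Lemma Delta_diag X : diag_algebra X -> Delta X = X.
Proof.
move=> /is_diag_mxP dX; apply/matrixP => i j; rewrite !mxE.
by case: eqVneq => [->|/dX ->].
Qed.

Lemma mxtrace_char_vec (S : {set 'I_d}) X :
  \tr (diag_of_real (char_vec R S) *m X) = \sum_(i in S) X i i.
Proof.
rewrite [RHS]big_mkcond; apply: eq_bigr => i _; rewrite mul_diag_mx !mxE.
by case: (i \in S); rewrite ?mul1r ?mul0r.
Qed.

Lemma char_vec_projection (S : {set 'I_d}) : projection (diag_of_real (char_vec R S)).
Proof.
split; apply/matrixP => i j; last first.
  by rewrite mul_diag_mx !mxE; case: (i \in S); rewrite ?mul1r ?mul0r ?mul0rn.
by rewrite !mxE eq_sym; case: eqVneq => [->|_]; case: (_ \in S); rewrite ?conjC0 ?conjC1.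
Qed.

(** The antiblocking polyhedron of the family F. For the cliques of a graph it
    is fvp by definition. *)
Definition antiblocker (F : {set 'I_d} -> Prop) : set 'rV[R]_d :=
  [set x | (forall i, 0 <= x 0 i) /\ forall S, F S -> \sum_(i in S) x 0 i <= 1].

(** Diagonal part of the polar of a class A of projections tied to a family F of
    coordinate sets: coordinate projections of F belong to A, and members of A
    are injective only on sets of F. The first link gives the inequalities of
    the antiblocker for every member of the polar, the second one with the
    greedy basis makes them sufficient. *)
Theorem sharp_her_hull (A : set 'M[R[i]]_d) (F : {set 'I_d} -> Prop) :
  (forall P, A P -> projection P) ->
  (forall S, F S -> A (diag_of_real (char_vec R S))) ->
  (forall P J, A P -> injective_on P J -> F J) ->
  let H := her (mx_closure (conv_hull A)) in
  Delta @` sharp H = diag_algebra `&` sharp H /\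
  diag_algebra `&` sharp H = diag_of_real @` antiblocker F.
Proof.
move=> projA charA injA H.
have sharp_antiblocker B : sharp H B ->
    exists2 b, antiblocker F b & Delta B = diag_of_real b.
  move=> [pB sB].
  have B0 i := positive_op_diag_ge0 _ i pB.
  have ReB i : (complex.Re (B i i))%:C = B i i by rewrite RRe_real // ger0_real.
  exists (\row_i complex.Re (B i i)); last first.
    by congr diag_mx; apply/rowP => i; rewrite !mxE ReB.
  split=> [i|S FS]; first by rewrite mxE -ler0c ReB.
  rewrite -lecR rmorph_sum /= (eq_bigr (fun i => B i i)) => [|i _]; last first.
    by rewrite mxE ReB.
  rewrite -mxtrace_char_vec; apply/sB/her_hull_projection; first exact: charA.
  exact: char_vec_projection.
have antiblocker_sharp b : antiblocker F b -> sharp H (diag_of_real b).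
  move=> [b0 bF]; split; first exact: positive_diag_of_real.
  apply: her_hull_mxtrace_le1 => // P AP.
  have [J injJ] := greedy_basis P (b 0) (projA P AP).
  rewrite -mxtrace_mul_diag => /le_trans; apply.
  by rewrite lecR; apply: bF; exact: injA injJ.
have diag_b b : diag_algebra (diag_of_real b : 'M[R[i]]_d) by exact: diag_mx_is_diag.
split; apply/seteqP; split=> X.
- move=> [B /sharp_antiblocker[b pb ->] <-].
  by split; [exact: diag_b|exact: antiblocker_sharp].
- by move=> [dX sX]; exists X; rewrite ?Delta_diag.
- by move=> [dX /sharp_antiblocker[b pb]]; rewrite Delta_diag // => ->; exists b.
- by move=> [b pb <-]; split; [exact: diag_b|exact: antiblocker_sharp].
Qed.

End Diagonal.

(** * Coordinate projections and the theorem *)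

Section Coordinate.
Local Open Scope ring_scope.
Local Open Scope complex_scope.
Local Open Scope sesquilinear_scope.
Context {R : realType} {d : nat} (e : rel 'I_d).
Implicit Types (S : {set 'I_d}) (X : 'M[R[i]]_d).
Local Notation S_G := (graph_system R e).
Local Notation chi S := (diag_of_real (char_vec R S)).

Lemma char_vec_sandwich S X i j :
  (chi S *m X *m chi S) i j = (i \in S)%:R * X i j * (j \in S)%:R.
Proof.
by rewrite mul_mx_diag mxE mul_diag_mx !mxE; case: (i \in S); case: (j \in S).
Qed.

Lemma char_vec_abelian S : independent e S -> abelian_projection S_G (chi S).
Proof.
move=> indS; split; first exact: char_vec_projection.
(* The diagonal matrices are the system of the edgeless graph. *)
pose D : {vspace 'M[R[i]]_d} := graph_system R (fun _ _ => false).
have DP X : X \in D <-> forall x y, x != y -> X x y = 0 by exact: graph_systemP.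
have DX X : X \in D -> X = diag_mx (\row_i X i i).
  move=> /DP X0; apply/matrixP => i j; rewrite !mxE.
  by case: eqVneq => [->|/X0->].
exists D; split; last first.
  move=> X /graph_systemP X0; apply/DP => x y xy; rewrite char_vec_sandwich.
  have [xS|] := boolP (x \in S); last by rewrite !mul0r.
  have [yS|] := boolP (y \in S); last by rewrite mulr0.
  by rewrite X0 ?mulr0 ?mul0r // negb_or xy (indS x y).
split=> [X /DP X0|X Y /DX-> /DX->|X Y /DX-> /DX->]; last exact: diag_mxC.
  by apply/DP => x y xy; rewrite !mxE X0 ?conjC0 // eq_sym.
by apply/DP => x y xy; rewrite mulmx_diag mxE (negbTE xy).
Qed.

Lemma char_vec_full S : clique e S -> full_projection S_G (chi S).
Proof.
move=> clS; split=> [|T eqT]; first exact: char_vec_projection.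
apply/graph_systemP => x y; rewrite negb_or => /andP[exy xy].
rewrite -eqT char_vec_sandwich.
have [xS|] := boolP (x \in S); last by rewrite !mul0r.
have [yS|] := boolP (y \in S); last by rewrite mulr0.
by rewrite (clS x y) in exy.
Qed.

Lemma char_vec_clique S : clique e S -> clique_projection S_G (chi S).
Proof.
move=> clS; split; first exact: char_vec_projection.
pose xi (i : 'I_#|S|) : 'cV[R[i]]_d := basis_vec (enum_val i).
have inner_basis x y : inner (basis_vec x) (basis_vec y) = (x == y)%:R :> R[i].
  by rewrite /inner trmx_delta map_delta_mx -rowE !mxE eqxx andbT eq_sym.
exists #|S|, xi; split.
  split=> i => [|j ij|j ij]; first by rewrite inner_basis eqxx.
    by rewrite inner_basis (inj_eq enum_val_inj) (negbTE ij).
  rewrite rank_one_basis; apply/delta_graph_system/clS; rewrite ?enum_valP //.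
  by rewrite (inj_eq enum_val_inj).
have xiP x : x \in S -> basis_vec x \in [seq xi i | i : 'I_#|S|].
  move=> xS; apply/fintype.imageP; exists (enum_rank_in xS x) => //.
  by rewrite /xi enum_rankK_in.
apply/seteqP; split=> v /=.
  move=> [w _ <-]; rewrite [_ *m _]matrix_sum_delta rpred_sum // => x _.
  rewrite big_ord1 mul_diag_mx !mxE.
  have [xS|_] := boolP (x \in S); last by rewrite mul0r scale0r rpred0.
  by rewrite rpredZ // memv_span // xiP.
(* The span is fixed by the projection, hence contained in its range. *)
move=> spanv; suff Pv : chi S *m v = v by exists v.
move: spanv => /(@coord_span _ _ _ (in_tuple _)); set L := image_mem _ _ => ->.
rewrite mulmx_sumr; apply: eq_bigr => i _; rewrite -scalemxAr; congr (_ *: _).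
have /fintype.imageP[j _ ->] : (in_tuple L)`_i \in L by rewrite mem_nth.
apply/matrixP => x y; rewrite ord1 mul_diag_mx !mxE.
have [xj|_] := eqVneq; last by rewrite mulr0.
by rewrite xj enum_valP mul1r.
Qed.

(** The inequalities defining the polar are linear, so they hold on vp as soon as
    they hold at the generators, the characteristic vectors. *)
Lemma flat_vp :
  flat (diag_of_real @` vp R e) = diag_of_real @` antiblocker (independent e).
Proof.
have trE (x b : 'rV[R]_d) : \tr (diag_of_real x *m diag_of_real b) =
    (\sum_i x 0 i * b 0 i)%:C.
  rewrite mxtrace_mul_diag rmorph_sum; apply: eq_bigr => i _.
  by rewrite !mxE eqxx /= -rmorphM.
have chiE S (b : 'rV[R]_d) : \sum_i char_vec R S 0 i * b 0 i = \sum_(i in S) b 0 i.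
  rewrite [RHS]big_mkcond; apply: eq_bigr => i _.
  by rewrite mxE; case: (i \in S); rewrite ?mul1r ?mul0r.
apply/seteqP; split=> [_ [/diag_algebra_posP[b b0 ->] tr_le1]|_ [b [b0 bF] <-]].
  exists b => //; split=> // S indS; rewrite -chiE -lecR -trE; apply: tr_le1.
  by exists (char_vec R S) => //; apply: sub_gen_smallest; exists S.
split; first by apply/diag_algebra_posP; exists b.
move=> _ [x vx <-]; rewrite trE lecR.
have lin_b : scalar (fun x : 'rV[R]_d => \sum_i x 0 i * b 0 i).
  move=> k u v; rewrite mulr_sumr -big_split; apply: eq_bigr => i _.
  by rewrite !mxE mulrDl mulrA.
apply: (conv_hull_le1 _ _ _ _ lin_b _ x vx) => _ [S indS ->].
by rewrite chiE bF.
Qed.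

End Coordinate.

(* The vertex set is 'I_d and e is the adjacency relation of the graph. *)
Theorem corollary3p7 (R : realType) (d : nat) (e : rel 'I_d)
    (e_sym : symmetric e) (e_irr : irreflexive e) :
  (Delta @` sharp (ap (graph_system R e))
     = diag_algebra `&` sharp (ap (graph_system R e)) /\
   diag_algebra `&` sharp (ap (graph_system R e))
     = flat (diag_of_real @` vp R e)) /\
  (Delta @` sharp (cp (graph_system R e))
     = diag_algebra `&` sharp (cp (graph_system R e)) /\
   diag_algebra `&` sharp (cp (graph_system R e))
     = diag_of_real @` fvp R e) /\
  (Delta @` sharp (fp (graph_system R e))
     = diag_algebra `&` sharp (fp (graph_system R e)) /\
   diag_algebra `&` sharp (fp (graph_system R e))
     = diag_of_real @` fvp R e).
Proof.
split; last split.
- rewrite flat_vp; apply: sharp_her_hull => [P []//|S|P J].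
    exact: char_vec_abelian.
  exact: abelian_projection_independent.
- apply: sharp_her_hull => [P []//|S|P J].
    exact: char_vec_clique.
  exact: clique_projection_clique.
- apply: sharp_her_hull => [P []//|S|P J].
    exact: char_vec_full.
  exact: full_projection_clique.
Qed.
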